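(* Suppose $\lambda_1>0$ and $\beta$ satisfies condition $(E)$. Let $\varphi$ be an entire function and $C_\varphi f=f\circ\varphi$. Then $C_\varphi$ is a bounded operator from $\mathcal{H}(E,\beta)$ into itself if and only if $\varphi(z)=z+b$ for some $b\in\mathbb{C}$ with $\operatorname{Re}(b)\ge0$. Moreover, in that case the operator norm is $\|C_\varphi\|=e^{-\lambda_1\operatorname{Re}(b)}$.
   Context: Fix a sequence $\Lambda=(\lambda_n)_{n\ge1}$ of real numbers with $0\le\lambda_1<\lambda_2<\cdots$ and $\lambda_n\to+\infty$, such that $\limsup_{n\to\infty}\frac{\log n}{\lambda_n}<+\infty$. For a sequence $\beta=(\beta_n)$ of positive reals, condition $(E)$ is: $\liminf_{n\to\infty}\frac{\log\beta_n}{\lambda_n}=+\infty$. Under $(E)$, $\mathcal{H}(E,\beta)$ denotes the Hilbert space of entire functions $f(z)=\sum_{n=1}^\infty a_ne^{-\lambda_nz}$ ($a_n\in\mathbb{C}$; the representation is unique) with norm $\|f\|=\big(\sum_{n=1}^\infty|a_n|^2\beta_n^2\big)^{1/2}<\infty$. *)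

(* Defs.v *)
From Stdlib Require Import Reals.
Open Scope R_scope.

Definition Cplx : Type := (R * R)%type.
Definition Re (z : Cplx) : R := fst z.
Definition Im (z : Cplx) : R := snd z.
Definition Cadd (z w : Cplx) : Cplx := (fst z + fst w, snd z + snd w).
Definition Csub (z w : Cplx) : Cplx := (fst z - fst w, snd z - snd w).
Definition Cmul (z w : Cplx) : Cplx :=
  (fst z * fst w - snd z * snd w, fst z * snd w + snd z * fst w).
Definition Cmod (z : Cplx) : R := sqrt (fst z ^ 2 + snd z ^ 2).

Definition Cexp_neg (lam : R) (z : Cplx) : Cplx :=
  (exp (- lam * fst z) * cos (lam * snd z), - (exp (- lam * fst z) * sin (lam * snd z))).

Definition series_C (u : nat -> Cplx) (s : Cplx) : Prop :=
  infinite_sum (fun n => fst (u n)) (fst s) /\ infinite_sum (fun n => snd (u n)) (snd s).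

Definition entire (phi : Cplx -> Cplx) : Prop :=
  forall z : Cplx, exists L : Cplx, forall eps : R, 0 < eps -> exists delta : R, 0 < delta /\
    forall h : Cplx, 0 < Cmod h < delta ->
      Cmod (Csub (Csub (phi (Cadd z h)) (phi z)) (Cmul L h)) <= eps * Cmod h.

(* Standing assumptions on Lambda (indexed from 0: lam 0 = lambda_1). *)
Definition Lambda_ok (lam : nat -> R) : Prop :=
  0 <= lam 0%nat /\ (forall n, lam n < lam (S n)) /\ cv_infty lam /\
  exists K : R, exists N : nat, forall n : nat, (N <= n)%nat ->
    ln (INR (S n)) / lam n <= K.

Definition CondE (lam beta : nat -> R) : Prop :=
  (forall n, 0 < beta n) /\
  forall M : R, exists N : nat, forall n : nat, (N <= n)%nat -> M <= ln (beta n) / lam n.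

(* InH lam beta f a r : f belongs to H(E,beta), represented by the coefficient
   sequence a (f z = sum a_n e^{-lam_n z} for all z), with norm r. *)
Definition InH (lam beta : nat -> R) (f : Cplx -> Cplx) (a : nat -> Cplx) (r : R) : Prop :=
  (exists s : R, infinite_sum (fun n => (Cmod (a n)) ^ 2 * (beta n) ^ 2) s /\ r = sqrt s) /\
  forall z : Cplx, series_C (fun n => Cmul (a n) (Cexp_neg (lam n) z)) (f z).

Definition comp (f phi : Cplx -> Cplx) : Cplx -> Cplx := fun z => f (phi z).

Definition bounded_comp (lam beta : nat -> R) (phi : Cplx -> Cplx) : Prop :=
  exists M : R, forall (f : Cplx -> Cplx) (a : nat -> Cplx) (r : R), InH lam beta f a r ->
    exists (c : nat -> Cplx) (r' : R), InH lam beta (comp f phi) c r' /\ r' <= M * r.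

(* values ||C_phi f|| for ||f|| <= 1; the operator norm is its supremum *)
Definition opnorm_set (lam beta : nat -> R) (phi : Cplx -> Cplx) (t : R) : Prop :=
  exists (f : Cplx -> Cplx) (a : nat -> Cplx) (r : R) (c : nat -> Cplx),
    InH lam beta f a r /\ r <= 1 /\ InH lam beta (comp f phi) c t.

(* Main.v *)
(** Testing a bounded C_phi on the reproducing kernels K_w, whose squared norms
    k(Re w) = sum e^{-2 lam_n Re w} / beta_n^2 satisfy
    k(x - h) >= e^{2 lam_0 h} k(x), gives Re phi(w) >= Re w - h for some
    constant h.  Hence F = e^{-lam_0 phi}, which is again a Dirichlet series
    sum c_n e^{-lam_n z}, satisfies |F(z)| <= C e^{-lam_0 Re z} on the whole plane.
    Since |c_n| e^{-lam_n x} <= sup_y |F(x + iy)|, letting x -> -oo kills all c_n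
    with n > 0, so phi(z) - z is constant; no Cauchy theory is needed.  The
    coefficient bound comes from averaging F over vertical shifts that cancel the
    other frequencies one at a time; it also gives uniqueness of the coefficients,
    from which Re b >= 0 and the operator norm are read off on monomials. *)

From Stdlib Require Import Reals Lra Lia.
From Coquelicot Require Import Rcomplements Rbar Hierarchy Lim_seq Series Continuity.
Require Import Defs.
Open Scope R_scope.

(** * Modulus and exponential on pairs of reals *)

Lemma Cplx_ext (z w : Cplx) : fst z = fst w -> snd z = snd w -> z = w.
Proof. destruct z, w; simpl; intros -> ->; reflexivity. Qed.

Lemma Cmod_nonneg (z : Cplx) : 0 <= Cmod z.
Proof. apply sqrt_pos. Qed.

Lemma Cmod_sqr (z : Cplx) : Cmod z ^ 2 = fst z ^ 2 + snd z ^ 2.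
Proof. unfold Cmod; apply pow2_sqrt; nra. Qed.

Lemma Cmod_le_of_sqr (z : Cplx) (y : R) : 0 <= y -> Cmod z ^ 2 <= y ^ 2 -> Cmod z <= y.
Proof. pose proof (Cmod_nonneg z); intros; nra. Qed.

Lemma Cmod_mul (z w : Cplx) : Cmod (Cmul z w) = Cmod z * Cmod w.
Proof. unfold Cmod; rewrite <- sqrt_mult by nra; f_equal; simpl; ring. Qed.

Lemma Cmod_fst (z : Cplx) : Rabs (fst z) <= Cmod z.
Proof.
  pose proof (Cmod_nonneg z); pose proof (Cmod_sqr z).
  apply Rabs_le; split; nra.
Qed.

Lemma Cmod_snd (z : Cplx) : Rabs (snd z) <= Cmod z.
Proof.
  pose proof (Cmod_nonneg z); pose proof (Cmod_sqr z).
  apply Rabs_le; split; nra.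
Qed.

(** Cauchy-Schwarz in the plane: by Lagrange's identity the squares of the two sides differ by
    [(fst z * snd w - snd z * fst w) ^ 2]. *)
Lemma inner_le_Cmod (z w : Cplx) : fst z * fst w + snd z * snd w <= Cmod z * Cmod w.
Proof.
  pose proof (Cmod_nonneg z); pose proof (Cmod_nonneg w).
  pose proof (Cmod_sqr z) as Hz; pose proof (Cmod_sqr w) as Hw.
  assert (0 <= Cmod z * Cmod w) by nra.
  assert ((Cmod z * Cmod w) ^ 2 = (fst z ^ 2 + snd z ^ 2) * (fst w ^ 2 + snd w ^ 2))
    by (rewrite <- Hz, <- Hw; ring).
  assert ((fst z * fst w + snd z * snd w) ^ 2 <= (Cmod z * Cmod w) ^ 2) by
    (pose proof (pow2_ge_0 (fst z * snd w - snd z * fst w)); nra).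
  nra.
Qed.

Lemma Cmod_add (z w : Cplx) : Cmod (Cadd z w) <= Cmod z + Cmod w.
Proof.
  pose proof (Cmod_nonneg z); pose proof (Cmod_nonneg w).
  apply Cmod_le_of_sqr; [lra|].
  pose proof (inner_le_Cmod z w).
  pose proof (Cmod_sqr z); pose proof (Cmod_sqr w).
  rewrite Cmod_sqr; simpl fst; simpl snd; nra.
Qed.

Lemma Cmod_zero : Cmod (0, 0) = 0.
Proof. unfold Cmod; simpl; rewrite !Rmult_0_l, Rplus_0_l; apply sqrt_0. Qed.

Lemma Cmod_real (x : R) : 0 <= x -> Cmod (x, 0) = x.
Proof.
  intros; unfold Cmod; simpl.
  transitivity (sqrt (x * x)); [f_equal; ring | now apply sqrt_square].
Qed.

Lemma Cmod_opp_one : Cmod (-1, 0) = 1.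
Proof. unfold Cmod; simpl; transitivity (sqrt 1); [f_equal; ring | apply sqrt_1]. Qed.

Lemma Cmod_eq_zero (z : Cplx) : Cmod z <= 0 -> z = (0, 0).
Proof.
  intros H; pose proof (Cmod_nonneg z); pose proof (Cmod_sqr z).
  apply Cplx_ext; simpl; nra.
Qed.

Lemma Cmod_Cexp_neg (l : R) (z : Cplx) : Cmod (Cexp_neg l z) = exp (- l * Re z).
Proof.
  assert (H := exp_pos (- l * Re z)).
  unfold Cmod, Cexp_neg; simpl; unfold Re in *.
  transitivity (sqrt (exp (- l * fst z) * exp (- l * fst z))); [|apply sqrt_square; lra].
  f_equal; pose proof (sin2_cos2 (l * snd z)) as E; unfold Rsqr in E.
  replace (exp (- l * fst z) * exp (- l * fst z)) with
    (exp (- l * fst z) * exp (- l * fst z) *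
     (sin (l * snd z) * sin (l * snd z) + cos (l * snd z) * cos (l * snd z)))
    by (rewrite E; ring).
  ring.
Qed.

Lemma Cexp_neg_add (l : R) (z w : Cplx) :
  Cexp_neg l (Cadd z w) = Cmul (Cexp_neg l z) (Cexp_neg l w).
Proof.
  unfold Cexp_neg, Cmul, Cadd; simpl.
  rewrite !Rmult_plus_distr_l, exp_plus, cos_plus, sin_plus.
  apply Cplx_ext; simpl; ring.
Qed.

(** A shift by [i t], followed by the phase that undoes it at frequency [l], leaves this unimodular
    factor on frequency [m]; it is 1 when [m = l]. *)
Lemma Cexp_neg_unit_mul (l m t : R) :
  Cmul (Cexp_neg l (0, - t)) (Cexp_neg m (0, t)) = Cexp_neg (m - l) (0, t).
Proof.
  unfold Cexp_neg, Cmul; simpl.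
  rewrite !Rmult_0_r, exp_0, Rmult_minus_distr_r, cos_minus, sin_minus.
  replace (l * - t) with (- (l * t)) by ring.
  rewrite cos_neg, sin_neg.
  apply Cplx_ext; simpl; ring.
Qed.

Lemma Cmul_assoc (u v w : Cplx) : Cmul u (Cmul v w) = Cmul (Cmul u v) w.
Proof. apply Cplx_ext; simpl; ring. Qed.

(** * Complex and real series *)

Lemma series_C_is_series (u : nat -> Cplx) (s : Cplx) :
  series_C u s <-> is_series (fun n => fst (u n)) (fst s) /\ is_series (fun n => snd (u n)) (snd s).
Proof. unfold series_C; rewrite <- !is_series_Reals; tauto. Qed.

Lemma is_series_linear (a b : nat -> R) (c d la lb : R) :
  is_series a la -> is_series b lb ->
  is_series (fun n => c * a n + d * b n) (c * la + d * lb).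
Proof.
  intros Ha Hb.
  apply (is_series_plus (fun n => c * a n) (fun n => d * b n)).
  - apply (is_series_scal c a la Ha).
  - apply (is_series_scal d b lb Hb).
Qed.

Lemma series_C_ext (u v : nat -> Cplx) (s : Cplx) :
  (forall n, u n = v n) -> series_C u s -> series_C v s.
Proof.
  rewrite !series_C_is_series; intros E [H1 H2]; split;
    (eapply is_series_ext; [|eassumption]); intros n; simpl; now rewrite E.
Qed.

Lemma series_C_add (u v : nat -> Cplx) (s t : Cplx) :
  series_C u s -> series_C v t -> series_C (fun n => Cadd (u n) (v n)) (Cadd s t).
Proof.
  rewrite !series_C_is_series; intros [H1 H2] [H3 H4]; split; simpl.
  - apply (is_series_plus _ _ _ _ H1 H3).
  - apply (is_series_plus _ _ _ _ H2 H4).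
Qed.

Lemma series_C_mul (c : Cplx) (u : nat -> Cplx) (s : Cplx) :
  series_C u s -> series_C (fun n => Cmul c (u n)) (Cmul c s).
Proof.
  rewrite !series_C_is_series; intros [H1 H2]; split; simpl.
  - replace (fst c * fst s - snd c * snd s) with (fst c * fst s + (- snd c) * snd s) by ring.
    eapply is_series_ext; [|apply (is_series_linear _ _ (fst c) (- snd c) _ _ H1 H2)].
    intros n; simpl; ring.
  - eapply is_series_ext; [|apply (is_series_linear _ _ (fst c) (snd c) _ _ H2 H1)].
    intros n; simpl; ring.
Qed.

Lemma is_series_le (a b : nat -> R) (la lb : R) :
  (forall n, a n <= b n) -> is_series a la -> is_series b lb -> la <= lb.
Proof.
  intros H Ha Hb.
  apply (is_lim_seq_le (sum_n a) (sum_n b) la lb);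
    [intros n; now apply sum_n_m_le | exact Ha | exact Hb].
Qed.

(** Pairing the series with its own sum [s] gives [|s|^2 <= |s| V] by comparing real series only. *)
Lemma series_C_Cmod_le (u : nat -> Cplx) (s : Cplx) (v : nat -> R) (V : R) :
  series_C u s -> is_series v V -> (forall n, Cmod (u n) <= v n) -> Cmod s <= V.
Proof.
  rewrite series_C_is_series; intros [H1 H2] Hv Hle.
  pose proof (Cmod_nonneg s) as Hs.
  assert (H : fst s * fst s + snd s * snd s <= Cmod s * V + 0 * V).
  { eapply is_series_le;
      [|apply (is_series_linear _ _ (fst s) (snd s) _ _ H1 H2)
       |apply (is_series_linear _ _ (Cmod s) 0 _ _ Hv Hv)].
    intros n; simpl.
    pose proof (inner_le_Cmod s (u n)); specialize (Hle n); nra. }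
  (* That [V] is nonnegative settles the case [s = 0], where [|s|] cannot be cancelled. *)
  assert (0 * V + 0 * V <= V).
  { eapply is_series_le; [|apply (is_series_linear _ _ 0 0 _ _ Hv Hv)|exact Hv].
    intros n; simpl; pose proof (Cmod_nonneg (u n)); specialize (Hle n); lra. }
  pose proof (Cmod_sqr s); nra.
Qed.

Lemma ex_series_dominated (a b : nat -> R) :
  (forall n, Rabs (a n) <= b n) -> ex_series b -> ex_series a.
Proof. exact (ex_series_le a b). Qed.

Definition Cseries (u : nat -> Cplx) : Cplx :=
  (Series (fun n => fst (u n)), Series (fun n => snd (u n))).

Lemma series_C_Cseries (u : nat -> Cplx) :
  ex_series (fun n => Cmod (u n)) -> series_C u (Cseries u).
Proof.
  intros H; apply series_C_is_series; split; apply Series_correct;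
    apply (ex_series_dominated _ (fun n => Cmod (u n))); try exact H;
    intros n; [apply Cmod_fst | apply Cmod_snd].
Qed.

Lemma is_series_eventually (a : nat -> R) (l : R) (N : nat) :
  (forall n, (N <= n)%nat -> sum_n a n = l) -> is_series a l.
Proof.
  intros H; change (is_lim_seq (sum_n a) l).
  apply is_lim_seq_ext_loc with (u := fun _ => l); [|apply is_lim_seq_const].
  exists N; intros n Hn; now rewrite H.
Qed.

(** Writing a partial sum as a full series makes a tail the termwise difference of two convergent
    series. *)
Lemma is_series_truncate (a : nat -> R) (N : nat) :
  is_series (fun n => if Nat.leb n N then a n else 0) (sum_f_R0 a N).
Proof.
  apply is_series_eventually with N; intros n Hn; rewrite sum_n_Reals.
  induction Hn as [|n Hn IH].
  - apply sum_eq; intros i Hi; now rewrite (proj2 (Nat.leb_le i N) Hi).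
  - rewrite tech5, IH.
    destruct (Nat.leb_spec (S n) N); [lia | apply Rplus_0_r].
Qed.

Lemma is_series_single (a : nat -> R) (m : nat) :
  (forall n, n <> m -> a n = 0) -> is_series a (a m).
Proof.
  intros H.
  assert (E : forall k, sum_n a k = if Nat.leb m k then a m else 0).
  { induction k as [|k IH].
    - rewrite sum_O; destruct (Nat.leb_spec m 0).
      + f_equal; lia.
      + apply H; lia.
    - rewrite sum_Sn, IH; change (plus ?x ?y) with (x + y).
      destruct (Nat.leb_spec m k), (Nat.leb_spec m (S k)); try lia.
      + rewrite (H (S k)) by lia; apply Rplus_0_r.
      + replace (S k) with m by lia; apply Rplus_0_l.
      + rewrite (H (S k)) by lia; apply Rplus_0_r. }
  apply is_series_eventually with m; intros n Hn; rewrite E.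
  now rewrite (proj2 (Nat.leb_le m n) Hn).
Qed.

Lemma series_C_single (u : nat -> Cplx) (m : nat) :
  (forall n, n <> m -> u n = (0, 0)) -> series_C u (u m).
Proof.
  intros H; apply series_C_is_series; split.
  - apply (is_series_single (fun n => fst (u n))); intros n Hn; now rewrite H.
  - apply (is_series_single (fun n => snd (u n))); intros n Hn; now rewrite H.
Qed.

(** * Coefficient bound by averaging over vertical shifts *)

(** The representation clause of [InH] without the norm condition, so that averages of shifted
    series need no weighted bound. *)
Definition dirichlet (lam : nat -> R) (c : nat -> Cplx) (F : Cplx -> Cplx) : Prop :=
  forall z, series_C (fun n => Cmul (c n) (Cexp_neg (lam n) z)) (F z).

(* The average of [F z] and [e^{i lam_m tau} F (z + i tau)] multiplies the n-th
   coefficient by [(1 + e^{-i (lam_n - lam_m) tau}) / 2]: this is 1 at n = m,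
   and 0 at n = N for [tau = PI / (lam_N - lam_m)]. *)
Lemma dirichlet_kill_one (lam : nat -> R) (c : nat -> Cplx) (F : Cplx -> Cplx)
    (m N : nat) (x B : R) :
  lam N <> lam m -> dirichlet lam c F -> (forall y, Cmod (F (x, y)) <= B) ->
  exists c' F', dirichlet lam c' F' /\ (forall y, Cmod (F' (x, y)) <= B) /\
    c' m = c m /\ c' N = (0, 0) /\ (forall n, Cmod (c' n) <= Cmod (c n)).
Proof.
  intros Hne HF HB.
  set (tau := PI / (lam N - lam m)).
  set (e := fun n => Cexp_neg (lam n - lam m) (0, tau)).
  set (w := fun n => Cmul (1/2, 0) (Cadd (1, 0) (e n))).
  assert (He : forall n, Cmod (e n) = 1).
  { intros n; unfold e; rewrite Cmod_Cexp_neg; simpl; rewrite Rmult_0_r; apply exp_0. }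
  exists (fun n => Cmul (c n) (w n)).
  exists (fun z => Cmul (1/2, 0) (Cadd (F z)
            (Cmul (Cexp_neg (lam m) (0, - tau)) (F (Cadd z (0, tau)))))).
  refine (conj _ (conj _ (conj _ (conj _ _)))).
  - intros z.
    pose proof (series_C_mul (1/2, 0) _ _ (series_C_add _ _ _ _ (HF z)
      (series_C_mul (Cexp_neg (lam m) (0, - tau)) _ _ (HF (Cadd z (0, tau)))))) as H.
    revert H; apply series_C_ext; intros n.
    unfold w, e; rewrite <- Cexp_neg_unit_mul, Cexp_neg_add.
    apply Cplx_ext; simpl; ring.
  - intros y; rewrite Cmod_mul, Cmod_real by lra.
    eapply Rle_trans; [apply Rmult_le_compat_l; [lra|apply Cmod_add]|].
    rewrite Cmod_mul, Cmod_Cexp_neg; simpl Re; rewrite Rmult_0_r, exp_0.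
    unfold Cadd; simpl; rewrite Rplus_0_r.
    pose proof (HB y); pose proof (HB (y + tau)); lra.
  - unfold w, e, Cexp_neg; simpl.
    rewrite Rminus_diag, Rmult_0_l, cos_0, sin_0, Rmult_0_r, exp_0.
    apply Cplx_ext; simpl; field.
  - unfold w, e, Cexp_neg; simpl.
    replace ((lam N - lam m) * tau) with PI by (unfold tau; field; lra).
    rewrite cos_PI, sin_PI, Rmult_0_r, exp_0.
    apply Cplx_ext; simpl; field.
  - intros n; rewrite Cmod_mul.
    (* The factor [w n] is the average of two numbers of modulus 1. *)
    assert (Cmod (w n) <= 1).
    { unfold w; rewrite Cmod_mul, Cmod_real by lra.
      pose proof (Cmod_add (1, 0) (e n)) as H.
      rewrite He, Cmod_real in H by lra; lra. }
    pose proof (Cmod_nonneg (c n)); nra.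
Qed.

(** The frequencies are cancelled one after another, skipping [m]. Coefficients already cancelled
    stay zero because no step increases a modulus. *)
Lemma dirichlet_kill (lam : nat -> R) (m : nat) (x B : R) :
  (forall n, n <> m -> lam n <> lam m) ->
  forall (c : nat -> Cplx) (F : Cplx -> Cplx) (N : nat),
  dirichlet lam c F -> (forall y, Cmod (F (x, y)) <= B) ->
  exists c' F', dirichlet lam c' F' /\ (forall y, Cmod (F' (x, y)) <= B) /\
    c' m = c m /\ (forall n, (n < N)%nat -> n <> m -> c' n = (0, 0)) /\
    (forall n, Cmod (c' n) <= Cmod (c n)).
Proof.
  intros Hinj c F N HF HB.
  induction N as [|N (c1 & F1 & HF1 & HB1 & Hm1 & Hz1 & Hle1)].
  - exists c, F; refine (conj _ (conj _ (conj _ (conj _ _)))); auto; [intros; lia | intros; lra].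
  - destruct (Nat.eq_dec N m) as [->|HNm].
    + exists c1, F1; refine (conj _ (conj _ (conj _ (conj _ _)))); auto; intros n Hn Hnm; apply Hz1; lia.
    + destruct (dirichlet_kill_one lam c1 F1 m N x B (Hinj N HNm) HF1 HB1)
        as (c2 & F2 & HF2 & HB2 & Hm2 & HN2 & Hle2).
      exists c2, F2; refine (conj _ (conj _ (conj _ (conj _ _)))); auto.
      * congruence.
      * intros n Hn Hnm; destruct (Nat.eq_dec n N) as [->|HnN]; [assumption|].
        apply Cmod_eq_zero; rewrite <- Cmod_zero, <- (Hz1 n) by lia; apply Hle2.
      * intros n; eapply Rle_trans; [apply Hle2|apply Hle1].
Qed.

(** Once all frequencies up to a large [N] other than [m] are cancelled, the averaged function at
    [x] differs from the [m]-th term by at most a tail of the absolutely convergent series, while it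
    is still bounded by [B]. *)
Lemma dirichlet_coef_bound (lam : nat -> R) (c : nat -> Cplx) (F : Cplx -> Cplx)
    (m : nat) (x B : R) :
  (forall n, n <> m -> lam n <> lam m) -> dirichlet lam c F ->
  ex_series (fun n => Cmod (c n) * exp (- lam n * x)) ->
  (forall y, Cmod (F (x, y)) <= B) ->
  Cmod (c m) * exp (- lam m * x) <= B.
Proof.
  intros Hinj HF [S HS] HB.
  apply le_epsilon; intros eps Heps.
  set (u := fun n => Cmod (c n) * exp (- lam n * x)) in *.
  assert (Hu : forall n, 0 <= u n)
    by (intros n; apply Rmult_le_pos; [apply Cmod_nonneg | left; apply exp_pos]).
  pose proof (proj1 (is_series_Reals _ _) HS) as HS'.
  destruct (HS' eps Heps) as [N HN]; specialize (HN N (le_n N)).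
  destruct (dirichlet_kill lam m x B Hinj c F (Datatypes.S N) HF HB)
    as (c' & F' & HF' & HB' & Hm & Hz & Hle).
  pose proof (is_series_truncate u N) as Ht.
  (* The [m]-th term as a series supported at [m], to be subtracted termwise from the series of
     [F']. *)
  set (D := fun n : nat => if Nat.eq_dec n m then Cmul (c m) (Cexp_neg (lam m) (x, 0)) else (0, 0) : Cplx).
  (* The term at [m] cancels, the other terms up to [N] vanish, and the rest is bounded by the tail
     of [u]. *)
  assert (HD : series_C D (D m)).
  { apply series_C_single; intros n Hn; unfold D; destruct (Nat.eq_dec n m); tauto. }
  assert (Hdiff : Cmod (Cadd (F' (x, 0)) (Cmul (-1, 0) (D m))) <= 1 * S + -1 * sum_f_R0 u N).
  { eapply series_C_Cmod_le;
      [apply (series_C_add _ _ _ _ (HF' (x, 0)) (series_C_mul (-1, 0) _ _ HD))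
      |apply (is_series_linear _ _ 1 (-1) _ _ HS Ht)|].
    intros n; simpl; unfold D; destruct (Nat.eq_dec n m) as [->|Hnm].
    - rewrite Hm.
      replace (Cadd _ _) with ((0, 0) : Cplx) by (apply Cplx_ext; simpl; ring).
      rewrite Cmod_zero; specialize (Hu m); destruct (Nat.leb m N); lra.
    - destruct (Nat.leb_spec n N) as [Hn|Hn].
      + rewrite Hz by (assumption || lia).
        replace (Cadd _ _) with ((0, 0) : Cplx) by (apply Cplx_ext; simpl; ring).
        rewrite Cmod_zero; lra.
      + replace (Cadd _ _) with (Cmul (c' n) (Cexp_neg (lam n) (x, 0)))
          by (apply Cplx_ext; simpl; ring).
        rewrite Cmod_mul, Cmod_Cexp_neg; simpl Re.
        specialize (Hle n); unfold u.
        pose proof (exp_pos (- lam n * x)); nra. }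
  assert (HDm : Cmod (D m) = u m).
  { unfold D; destruct (Nat.eq_dec m m); [|tauto].
    rewrite Cmod_mul, Cmod_Cexp_neg; reflexivity. }
  change (u m <= B + eps); rewrite <- HDm.
  replace (D m) with (Cadd (F' (x, 0)) (Cmul (-1, 0) (Cadd (F' (x, 0)) (Cmul (-1, 0) (D m)))))
    by (apply Cplx_ext; simpl; ring).
  eapply Rle_trans; [apply Cmod_add|].
  rewrite Cmod_mul, Cmod_opp_one.
  unfold Rdist in HN; apply Rabs_def2 in HN.
  specialize (HB' 0); lra.
Qed.

(** * Growth of the frequencies and weights, and absolute convergence *)

Lemma Lambda_ok_lt (lam : nat -> R) (m n : nat) : Lambda_ok lam -> (m < n)%nat -> lam m < lam n.
Proof.
  intros (_ & Hinc & _) Hmn.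
  induction Hmn as [|n Hmn IH]; [apply Hinc | pose proof (Hinc n); lra].
Qed.

Lemma Lambda_ok_ge0 (lam : nat -> R) (n : nat) : Lambda_ok lam -> lam 0%nat <= lam n.
Proof.
  intros H; destruct n as [|n]; [lra|].
  left; apply Lambda_ok_lt; [assumption|lia].
Qed.

Lemma Lambda_ok_inj (lam : nat -> R) (m n : nat) : Lambda_ok lam -> n <> m -> lam n <> lam m.
Proof.
  intros H Hnm; destruct (Nat.lt_gt_cases n m) as [Hlt _]; destruct (Hlt Hnm) as [L|L];
    pose proof (Lambda_ok_lt lam _ _ H L); lra.
Qed.

(** Comparison with a telescoping series; the factor 2 comes from [t * (t + 1) <= 2 * t ^ 2] for
    [t >= 1]. *)
Lemma ex_series_inv_sqr : ex_series (fun n => / INR (S n) ^ 2).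
Proof.
  apply (ex_series_dominated (fun n => / INR (S n) ^ 2) (fun n => 2 * (/ INR (S n) - / INR (S (S n))))).
  - intros n; change (Rabs (/ INR (S n) ^ 2) <= 2 * (/ INR (S n) - / INR (S (S n)))).
    assert (H : 1 <= INR (S n)) by (rewrite S_INR; pose proof (pos_INR n); lra).
    rewrite (S_INR (S n)); set (t := INR (S n)) in *.
    rewrite Rabs_pos_eq by (left; apply Rinv_0_lt_compat; nra).
    replace (2 * (/ t - / (t + 1))) with (2 * / (t * (t + 1))) by (field; lra).
    replace (/ t ^ 2) with (2 * / (2 * t ^ 2)) by (field; lra).
    apply Rmult_le_compat_l; [lra|apply Rinv_le_contravar; nra].
  - apply (ex_series_scal 2 (fun n => / INR (S n) - / INR (S (S n)))).
    exists 1; change (is_lim_seq (sum_n (fun n => / INR (S n) - / INR (S (S n)))) 1).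
    apply is_lim_seq_ext with (u := fun n => 1 - / INR (S (S n))).
    + induction n as [|n IH].
      * rewrite sum_O; simpl; field.
      * rewrite sum_Sn, <- IH; change (plus ?x ?y) with (x + y); ring.
    + replace (Finite 1) with (Finite (1 - 0)) by (f_equal; ring).
      apply is_lim_seq_minus'; [apply is_lim_seq_const|].
      apply -> (is_lim_seq_incr_1 (fun n => / INR (S n)) 0).
      apply -> (is_lim_seq_incr_1 (fun n => / INR n) 0).
      apply (is_lim_seq_inv INR p_infty is_lim_seq_INR); discriminate.
Qed.

Lemma exp_pow2 (x : R) : exp x ^ 2 = exp (2 * x).
Proof. replace (2 * x) with (x + x) by ring; rewrite exp_plus; ring. Qed.

(* The squared norm of the reproducing kernel at a point of real part x is the
   sum of the [kernel_term]s. *)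
Definition kernel_term (lam beta : nat -> R) (x : R) (n : nat) : R :=
  (exp (- lam n * x) / beta n) ^ 2.

(** Eventually [ln (n + 1) <= K * lam n] and [ln (beta n) >= (K - x) * lam n], so [exp (- lam n * x)
    / beta n <= exp (- K * lam n) <= 1 / (n + 1)], whose squares are summable. *)
Lemma ex_series_kernel (lam beta : nat -> R) (x : R) :
  Lambda_ok lam -> 0 < lam 0%nat -> CondE lam beta -> ex_series (kernel_term lam beta x).
Proof.
  intros HL H0 (Hb & HE).
  pose proof HL as (_ & _ & _ & K & N1 & HK).
  destruct (HE (K - x)) as [N2 HM].
  apply (ex_series_incr_n _ (N1 + N2)).
  apply (ex_series_dominated _ (fun k => / INR (S ((N1 + N2) + k)) ^ 2)).
  2: apply (ex_series_incr_n (fun n => / INR (S n) ^ 2) (N1 + N2)), ex_series_inv_sqr.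
  intros k; set (n := ((N1 + N2) + k)%nat).
  change (Rabs (kernel_term lam beta x n) <= / INR (S n) ^ 2); unfold kernel_term.
  rewrite Rabs_pos_eq by apply pow2_ge_0.
  assert (Hl : 0 < lam n) by (pose proof (Lambda_ok_ge0 lam n HL); lra).
  assert (Hn : 0 < INR (S n)) by (apply lt_0_INR; lia).
  specialize (HK n ltac:(lia)); specialize (HM n ltac:(lia)); specialize (Hb n).
  apply Rle_div_l in HK; [|assumption].
  apply Rle_div_r in HM; [|assumption].
  rewrite <- (exp_ln (beta n)), <- (exp_ln (INR (S n))) by assumption.
  unfold Rdiv; rewrite <- exp_Ropp, <- exp_plus, !exp_pow2, <- exp_Ropp.
  destruct (Rle_lt_or_eq_dec (2 * (- lam n * x + - ln (beta n))) (- (2 * ln (INR (S n)))))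
    as [Hlt | ->]; [nra | left; now apply exp_increasing | lra].
Qed.

(** AM-GM applied to the factors [Cmod (a n) * beta n] and [exp (- lam n * x) / beta n], both square
    summable. *)
Lemma ex_series_coef_exp (lam beta : nat -> R) (a : nat -> Cplx) (x : R) :
  Lambda_ok lam -> 0 < lam 0%nat -> CondE lam beta ->
  ex_series (fun n => Cmod (a n) ^ 2 * beta n ^ 2) ->
  ex_series (fun n => Cmod (a n) * exp (- lam n * x)).
Proof.
  intros HL H0 HE [A HA].
  destruct (ex_series_kernel lam beta x HL H0 HE) as [k Hk].
  apply (ex_series_dominated _ (fun n => / 2 * (Cmod (a n) ^ 2 * beta n ^ 2) + / 2 * kernel_term lam beta x n)).
  2: eexists; apply (is_series_linear _ _ _ _ _ _ HA Hk).
  intros n; pose proof (exp_pos (- lam n * x)); pose proof (Cmod_nonneg (a n)).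
  pose proof (proj1 HE n).
  change (Rabs (Cmod (a n) * exp (- lam n * x)) <=
    / 2 * (Cmod (a n) ^ 2 * beta n ^ 2) + / 2 * kernel_term lam beta x n).
  rewrite Rabs_pos_eq by nra; unfold kernel_term.
  set (e := exp (- lam n * x) / beta n).
  replace (exp (- lam n * x)) with (e * beta n) by (unfold e; field; lra).
  pose proof (pow2_ge_0 (Cmod (a n) * beta n - e)); nra.
Qed.

(** * Coefficients and monomials in the space *)

Lemma InH_ex_series (lam beta : nat -> R) (f : Cplx -> Cplx) (a : nat -> Cplx) (r : R) :
  InH lam beta f a r -> ex_series (fun n => Cmod (a n) ^ 2 * beta n ^ 2).
Proof. intros [(s & Hs & _) _]; exists s; now apply is_series_Reals. Qed.

(** The difference of the two series represents the zero function, so the coefficient bound at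
    [x = 0] with [B = 0] annihilates each of its coefficients. *)
Lemma InH_unique (lam beta : nat -> R) (f : Cplx -> Cplx) (a c : nat -> Cplx) (r r' : R) :
  Lambda_ok lam -> 0 < lam 0%nat -> CondE lam beta ->
  InH lam beta f a r -> InH lam beta f c r' -> forall n, a n = c n.
Proof.
  intros HL H0 HE Ha Hc m.
  set (d := fun n => Cadd (a n) (Cmul (-1, 0) (c n))).
  assert (Hd : dirichlet lam d (fun _ => (0, 0))).
  { intros z.
    pose proof (series_C_add _ _ _ _ (proj2 Ha z) (series_C_mul (-1, 0) _ _ (proj2 Hc z))) as H.
    replace (Cadd (f z) (Cmul (-1, 0) (f z))) with ((0, 0) : Cplx) in H
      by (apply Cplx_ext; simpl; ring).
    revert H; apply series_C_ext; intros n; apply Cplx_ext; simpl; ring. }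
  assert (Hs : ex_series (fun n => Cmod (d n) * exp (- lam n * 0))).
  { destruct (ex_series_coef_exp lam beta a 0 HL H0 HE (InH_ex_series _ _ _ _ _ Ha)) as [A HA].
    destruct (ex_series_coef_exp lam beta c 0 HL H0 HE (InH_ex_series _ _ _ _ _ Hc)) as [C HC].
    apply (ex_series_dominated _ (fun n => 1 * (Cmod (a n) * exp (- lam n * 0)) + 1 * (Cmod (c n) * exp (- lam n * 0)))).
    2: eexists; apply (is_series_linear _ _ _ _ _ _ HA HC).
    intros n.
    change (Rabs (Cmod (d n) * exp (- lam n * 0)) <=
      1 * (Cmod (a n) * exp (- lam n * 0)) + 1 * (Cmod (c n) * exp (- lam n * 0))).
    rewrite Rmult_0_r, exp_0, Rabs_pos_eq by (pose proof (Cmod_nonneg (d n)); lra).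
    pose proof (Cmod_add (a n) (Cmul (-1, 0) (c n))) as H.
    rewrite Cmod_mul, Cmod_opp_one in H; fold (d n) in H; lra. }
  pose proof (dirichlet_coef_bound lam d _ m 0 0
    (fun n => Lambda_ok_inj lam m n HL) Hd Hs
    (fun _ => Req_le _ _ Cmod_zero)) as Hm.
  rewrite Rmult_0_r, exp_0, Rmult_1_r in Hm.
  apply Cmod_eq_zero in Hm; unfold d in Hm.
  injection Hm; intros; apply Cplx_ext; simpl in *; lra.
Qed.

Lemma InH_monomial (lam beta : nat -> R) (m : nat) (k : Cplx) :
  0 < beta m ->
  InH lam beta (fun z => Cmul k (Cexp_neg (lam m) z))
    (fun n => if Nat.eq_dec n m then k else (0, 0)) (Cmod k * beta m).
Proof.
  intros Hb; split.
  - exists (Cmod k ^ 2 * beta m ^ 2); split.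
    + apply is_series_Reals.
      set (u := fun n => Cmod (if Nat.eq_dec n m then k else (0, 0)) ^ 2 * beta n ^ 2).
      replace (Cmod k ^ 2 * beta m ^ 2) with (u m)
        by (unfold u; destruct (Nat.eq_dec m m); tauto).
      apply is_series_single; intros n Hn; unfold u.
      destruct (Nat.eq_dec n m); [tauto|]; rewrite Cmod_zero; ring.
    + replace (Cmod k ^ 2 * beta m ^ 2) with ((Cmod k * beta m) * (Cmod k * beta m)) by ring.
      rewrite sqrt_square; [reflexivity|].
      apply Rmult_le_pos; [apply Cmod_nonneg|lra].
  - intros z.
    set (u := fun n => Cmul (if Nat.eq_dec n m then k else (0, 0)) (Cexp_neg (lam n) z)).
    replace (Cmul k (Cexp_neg (lam m) z)) with (u m)
      by (unfold u; destruct (Nat.eq_dec m m); tauto).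
    apply series_C_single; intros n Hn; unfold u.
    destruct (Nat.eq_dec n m); [tauto|]; apply Cplx_ext; simpl; ring.
Qed.

(** * Testing boundedness on reproducing kernels *)

(** Norms are nonnegative, so the bound may be enlarged to [Rabs M + 1]; a positive bound can then
    serve as a divisor. *)
Lemma bounded_comp_pos (lam beta : nat -> R) (phi : Cplx -> Cplx) :
  bounded_comp lam beta phi ->
  exists M : R, 0 < M /\ forall (f : Cplx -> Cplx) (a : nat -> Cplx) (r : R), InH lam beta f a r ->
    exists (c : nat -> Cplx) (r' : R), InH lam beta (comp f phi) c r' /\ r' <= M * r.
Proof.
  intros [M HM]; exists (Rabs M + 1); split; [pose proof (Rabs_pos M); lra|].
  intros f a r H; destruct (HM f a r H) as (c & r' & Hc & Hle).
  exists c, r'; split; [assumption|].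
  destruct H as [(s & _ & ->) _].
  pose proof (sqrt_pos s); pose proof (Rle_abs M); nra.
Qed.

(* Boundedness is tested on the reproducing kernel at [phi w]; AM-GM with weight
   [M^2] replaces the Cauchy-Schwarz inequality. *)
Lemma kernel_comp_le (lam beta : nat -> R) (phi : Cplx -> Cplx) (M : R) :
  Lambda_ok lam -> 0 < lam 0%nat -> CondE lam beta -> 0 < M ->
  (forall (f : Cplx -> Cplx) (a : nat -> Cplx) (r : R), InH lam beta f a r ->
    exists (c : nat -> Cplx) (r' : R), InH lam beta (comp f phi) c r' /\ r' <= M * r) ->
  forall (w : Cplx) (p q : R),
  is_series (kernel_term lam beta (Re (phi w))) p ->
  is_series (kernel_term lam beta (Re w)) q -> p <= M ^ 2 * q.
Proof.
  intros HL H0 HE HMpos HM w p q Hp Hq.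
  set (e := fun n => Cexp_neg (lam n) (phi w)).
  (* Coefficients of the reproducing kernel at [phi w]: the conjugate of [e n] over [beta n ^ 2]. *)
  set (a := fun n => Cmul (/ beta n ^ 2, 0) (fst (e n), - snd (e n))).
  assert (Hmod : forall n, Cmod (a n) ^ 2 * beta n ^ 2 = kernel_term lam beta (Re (phi w)) n).
  { intros n; pose proof (proj1 HE n) as Hb.
    assert (Hib : 0 < / beta n ^ 2) by (apply Rinv_0_lt_compat; nra).
    unfold a; rewrite Cmod_mul, Cmod_real by lra.
    replace (Cmod (fst (e n), - snd (e n))) with (Cmod (e n))
      by (unfold Cmod; f_equal; simpl; ring).
    unfold e; rewrite Cmod_Cexp_neg; unfold kernel_term; field; lra. }
  assert (Ha : is_series (fun n => Cmod (a n) ^ 2 * beta n ^ 2) p)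
    by (eapply is_series_ext; [intros n; symmetry; apply Hmod | exact Hp]).
  set (f := fun z => Cseries (fun n => Cmul (a n) (Cexp_neg (lam n) z))).
  assert (Hf : InH lam beta f a (sqrt p)).
  { split; [exists p; split; [now apply is_series_Reals | reflexivity]|].
    intros z; apply series_C_Cseries.
    eapply ex_series_ext;
      [|apply (ex_series_coef_exp lam beta a (Re z) HL H0 HE); exists p; exact Ha].
    intros n; simpl; now rewrite Cmod_mul, Cmod_Cexp_neg. }
  destruct (HM f a _ Hf) as (c & r' & Hc & Hle).
  (* The value of the kernel at its own point is its squared norm. *)
  assert (Hval : fst (f (phi w)) = p).
  { transitivity (Series (kernel_term lam beta (Re (phi w)))); [|now apply is_series_unique].
    simpl; apply Series_ext; intros n; rewrite <- Hmod.
    unfold a; rewrite Cmod_mul, Rpow_mult_distr, !Cmod_sqr; fold (e n); simpl.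
    pose proof (proj1 HE n); field; lra. }
  destruct Hc as [(s & Hs & ->) Hc].
  apply is_series_Reals in Hs.
  assert (Hpos : forall u l, (forall n, 0 <= u n) -> is_series u l -> 0 <= l).
  { intros u l Hu Hl.
    assert (0 * l + 0 * l <= l); [|lra].
    eapply is_series_le; [|apply (is_series_linear _ _ 0 0 _ _ Hl Hl)|exact Hl].
    intros n; simpl; specialize (Hu n); lra. }
  assert (Hp0 : 0 <= p) by (apply (Hpos _ _ (fun n => pow2_ge_0 _) Hp)).
  assert (Hs0 : 0 <= s).
  { refine (Hpos _ _ _ Hs); intros n; cbv beta; rewrite <- Rpow_mult_distr; apply pow2_ge_0. }
  assert (Hsp : s <= M ^ 2 * p).
  { rewrite <- (pow2_sqrt s), <- (pow2_sqrt p), <- Rpow_mult_distr by assumption.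
    apply pow_incr; split; [apply sqrt_pos|assumption]. }
  assert (Hev : Cmod (comp f phi w) <= / (2 * M ^ 2) * s + M ^ 2 / 2 * q).
  { eapply series_C_Cmod_le; [apply (Hc w)|apply (is_series_linear _ _ _ _ _ _ Hs Hq)|].
    intros n; simpl; rewrite Cmod_mul, Cmod_Cexp_neg; unfold kernel_term.
    pose proof (proj1 HE n).
    set (E := exp (- lam n * Re w) / beta n).
    replace (exp (- lam n * Re w)) with (E * beta n) by (unfold E; field; lra).
    pose proof (pow2_ge_0 (Cmod (c n) * beta n / M - M * E)) as Hsq.
    replace ((Cmod (c n) * beta n / M - M * E) ^ 2) with
      (2 * (/ (2 * (M * (M * 1))) * (Cmod (c n) * (Cmod (c n) * 1) * (beta n * (beta n * 1)))
       + M * (M * 1) / 2 * (E * (E * 1)) - Cmod (c n) * (E * beta n))) in Hsq by (field; lra).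
    lra. }
  pose proof (Cmod_fst (comp f phi w)) as H1; unfold comp in H1, Hev; rewrite Hval in H1.
  pose proof (Rle_abs p).
  (* The first term of the bound is at most [p / 2]; absorbing it on the left leaves
     [p <= M ^ 2 * q]. *)
  assert (/ (2 * M ^ 2) * s <= / (2 * M ^ 2) * (M ^ 2 * p)).
  { apply Rmult_le_compat_l; [|assumption].
    left; apply Rinv_0_lt_compat; nra. }
  replace (/ (2 * M ^ 2) * (M ^ 2 * p)) with (p / 2) in * by (field; lra).
  lra.
Qed.

Lemma exp_le_mono (x y : R) : x <= y -> exp x <= exp y.
Proof. intros [H | ->]; [left; now apply exp_increasing | lra]. Qed.

(** Were [phi] to move [w] to the left by more than [h], the squared kernel norm would grow by a
    factor [exp (2 * lam 0 * h)], whereas boundedness allows at most [M ^ 2]. *)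
Lemma Re_comp_ge (lam beta : nat -> R) (phi : Cplx -> Cplx) :
  Lambda_ok lam -> 0 < lam 0%nat -> CondE lam beta -> bounded_comp lam beta phi ->
  exists h, forall w, Re w - h <= Re (phi w).
Proof.
  intros HL H0 HE HB.
  destruct (bounded_comp_pos _ _ _ HB) as (M & HMpos & HM).
  (* Chosen so that the growth factor is [exp (M ^ 2)], which exceeds [M ^ 2]. *)
  exists (M ^ 2 / (2 * lam 0%nat)); intros w.
  destruct (Rle_or_lt (Re w - M ^ 2 / (2 * lam 0%nat)) (Re (phi w))) as [|Hlt]; [assumption|exfalso].
  set (h := M ^ 2 / (2 * lam 0%nat)) in *.
  assert (Hh : 2 * (lam 0%nat * h) = M ^ 2) by (unfold h; field; lra).
  destruct (ex_series_kernel lam beta (Re (phi w)) HL H0 HE) as [p Hp].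
  destruct (ex_series_kernel lam beta (Re w) HL H0 HE) as [q Hq].
  pose proof (kernel_comp_le lam beta phi M HL H0 HE HMpos HM w p q Hp Hq) as Hpq.
  assert (Hexp : 1 + M ^ 2 < exp (M ^ 2)) by (apply exp_ineq1; nra).
  assert (Hq0 : 0 < q).
  { set (k0 := fun n : nat => if Nat.eq_dec n 0 then kernel_term lam beta (Re w) 0 else 0).
    apply Rlt_le_trans with (k0 0%nat).
    - unfold k0; simpl; unfold kernel_term.
      apply pow_lt, Rdiv_lt_0_compat; [apply exp_pos | apply (proj1 HE)].
    - eapply is_series_le; [|apply (is_series_single k0 0)|exact Hq].
      + intros n; unfold k0; destruct (Nat.eq_dec n 0) as [->|]; [lra|apply pow2_ge_0].
      + intros n Hn; unfold k0; destruct (Nat.eq_dec n 0); tauto. }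
  assert (Hge : exp (M ^ 2) * q + 0 * q <= p).
  { eapply is_series_le; [|apply (is_series_linear _ _ _ _ _ _ Hq Hq)|exact Hp].
    intros n; simpl; pose proof (proj1 HE n) as Hb.
    pose proof (Lambda_ok_ge0 lam n HL) as Hl.
    unfold kernel_term, Rdiv; rewrite !Rpow_mult_distr, !exp_pow2, Rmult_0_l, Rplus_0_r.
    rewrite <- Rmult_assoc, <- exp_plus.
    apply Rmult_le_compat_r; [apply pow2_ge_0|].
    apply exp_le_mono.
    assert (0 <= h) by (unfold h; apply Rle_mult_inv_pos; nra).
    assert (lam 0%nat * h <= lam n * (Re w - Re (phi w))).
    { apply Rle_trans with (lam n * h); [nra|]. apply Rmult_le_compat_l; lra. }
    simpl in Hh |- *; lra. }
  nra.
Qed.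

(** * Recovering a continuous function from its exponential *)

(** Differentiability with tolerance 1 bounds the increment by [(Cmod L + 1) * Cmod h] near [w]. *)
Lemma entire_continuous (phi : Cplx -> Cplx) (w : Cplx) (eps : R) :
  entire phi -> 0 < eps ->
  exists delta, 0 < delta /\ forall h, Cmod h < delta -> Cmod (Csub (phi (Cadd w h)) (phi w)) < eps.
Proof.
  intros Hphi Heps; destruct (Hphi w) as [L HL].
  destruct (HL 1 Rlt_0_1) as (d & Hd & Hh).
  pose proof (Cmod_nonneg L).
  exists (Rmin d (eps / (Cmod L + 1))); split.
  - apply Rmin_glb_lt; [assumption|apply Rdiv_lt_0_compat; lra].
  - intros h Hlt; pose proof (Rmin_l d (eps / (Cmod L + 1))).
    pose proof (Rmin_r d (eps / (Cmod L + 1))).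
    destruct (Cmod_nonneg h) as [Hpos|Hz].
    + specialize (Hh h ltac:(lra)).
      replace (Csub (phi (Cadd w h)) (phi w)) with
        (Cadd (Csub (Csub (phi (Cadd w h)) (phi w)) (Cmul L h)) (Cmul L h))
        by (apply Cplx_ext; simpl; ring).
      eapply Rle_lt_trans; [apply Cmod_add|]; rewrite Cmod_mul.
      assert (Cmod h * (Cmod L + 1) < eps) by (apply Rlt_div_r; lra).
      lra.
    (* The derivative condition excludes [h = 0], so this case is treated apart. *)
    + rewrite (Cmod_eq_zero h) by lra.
      replace (Cadd w (0, 0)) with w by (apply Cplx_ext; simpl; ring).
      replace (Csub (phi w) (phi w)) with ((0, 0) : Cplx) by (apply Cplx_ext; simpl; ring).
      rewrite Cmod_zero; assumption.
Qed.

(** Restriction to the line through 0 and [z] makes the real intermediate value theorem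
    available. *)
Lemma continuity_Im_line (phi : Cplx -> Cplx) (z : Cplx) :
  entire phi -> continuity (fun t => Im (phi (t * fst z, t * snd z))).
Proof.
  intros Hphi t eps Heps.
  destruct (entire_continuous phi (t * fst z, t * snd z) eps Hphi Heps) as (d & Hd & Hc).
  pose proof (Cmod_nonneg z).
  exists (d / (Cmod z + 1)); split; [apply Rdiv_lt_0_compat; lra|].
  intros s [_ Hs]; simpl in Hs |- *; unfold Rdist in *.
  specialize (Hc (Cmul (s - t, 0) z)).
  replace (Cadd (t * fst z, t * snd z) (Cmul (s - t, 0) z)) with ((s * fst z, s * snd z) : Cplx)
    in Hc by (apply Cplx_ext; simpl; ring).
  eapply Rle_lt_trans; [apply (Cmod_snd (Csub _ _))|apply Hc].
  rewrite Cmod_mul.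
  replace (Cmod (s - t, 0)) with (Rabs (s - t)).
  - apply Rlt_div_r in Hs; [|lra]; pose proof (Rabs_pos (s - t)); nra.
  - unfold Cmod; simpl; rewrite <- sqrt_Rsqr_abs; f_equal; unfold Rsqr; ring.
Qed.

(** By [1 - cos y = 2 sin^2 (y / 2)] the sine of [y / 2] vanishes, while [|y / 2| <= 1 / 2 < PI]. *)
Lemma cos_eq_1_small (y : R) : Rabs y <= 1 -> cos y = 1 -> y = 0.
Proof.
  intros Hy Hc; apply Rabs_le_between in Hy.
  replace y with (2 * (y / 2)) in Hc by field.
  rewrite cos_2a_sin in Hc.
  assert (Hs : sin (y / 2) = 0) by nra.
  pose proof PI2_1 as HPI.
  destruct (Rtotal_order y 0) as [Hlt|[?|Hgt]]; [|assumption|].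
  - pose proof (sin_gt_0 (- (y / 2)) ltac:(lra) ltac:(lra)) as H; rewrite sin_neg in H; lra.
  - pose proof (sin_gt_0 (y / 2) ltac:(lra) ltac:(lra)); lra.
Qed.

Lemma continuous_cos_eq_1 (g : R -> R) :
  continuity g -> g 0 = 0 -> (forall t, cos (g t) = 1) -> forall t, g t = 0.
Proof.
  intros Hg H0 Hc t.
  (* Clamping [g t] to [[-1, 1]] keeps it between [g 0] and [g t], so [g] attains [y]; the clamped
     value is zero only if [g t] is. *)
  set (y := Rmax (-1) (Rmin 1 (g t))).
  assert (Hy : Rabs y <= 1).
  { apply Rabs_le; unfold y; split; [apply Rmax_l|].
    apply Rmax_lub; [lra|apply Rmin_l]. }
  destruct (IVT_gen g 0 t y Hg) as (s & _ & Hs).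
  { rewrite H0; unfold y, Rmin, Rmax.
    repeat destruct Rle_dec; lra. }
  assert (y = 0) by (apply cos_eq_1_small; [assumption|rewrite <- Hs; apply Hc]).
  revert H; unfold y, Rmin, Rmax; repeat destruct Rle_dec; lra.
Qed.

(** The exponential of [psi z = phi z - z] is the constant [k]. Its modulus fixes the real part of
    [psi], its argument fixes the imaginary part up to multiples of [2 * PI / l], and continuity
    along lines through 0 rules out jumps. *)
Lemma translation_of_Cexp_neg (l : R) (k : Cplx) (phi : Cplx -> Cplx) :
  0 < l -> entire phi -> (forall z, Cexp_neg l (phi z) = Cmul k (Cexp_neg l z)) ->
  exists b, forall z, phi z = Cadd z b.
Proof.
  intros Hl Hphi H.
  set (psi := fun z => Csub (phi z) z).
  assert (Hpsi : forall z, Cexp_neg l (psi z) = k).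
  { intros z.
    replace (psi z) with (Cadd (phi z) (- fst z, - snd z)) by (apply Cplx_ext; simpl; ring).
    rewrite Cexp_neg_add, H, <- Cmul_assoc, <- Cexp_neg_add.
    replace (Cadd z (- fst z, - snd z)) with ((0, 0) : Cplx) by (apply Cplx_ext; simpl; ring).
    unfold Cexp_neg; simpl; rewrite !Rmult_0_r, exp_0, cos_0, sin_0.
    apply Cplx_ext; simpl; ring. }
  set (o := (0, 0) : Cplx).
  assert (HRe : forall z, Re (psi z) = Re (psi o)).
  { intros z.
    assert (E : Cmod (Cexp_neg l (psi z)) = Cmod (Cexp_neg l (psi o))) by now rewrite !Hpsi.
    rewrite !Cmod_Cexp_neg in E; apply exp_inv in E.
    apply Rmult_eq_reg_l with (- l); [exact E | lra]. }
  assert (Hcos : forall z, cos (l * (Im (psi z) - Im (psi o))) = 1).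
  { intros z.
    pose proof (Hpsi z) as E; rewrite <- (Hpsi o) in E.
    pose proof (HRe z) as HR; unfold Re in HR.
    unfold Cexp_neg in E; rewrite HR in E; injection E as Ec Es.
    apply (f_equal Ropp) in Es; rewrite !Ropp_involutive in Es.
    pose proof (exp_pos (- l * fst (psi o))) as Hpos.
    assert (Ec' : cos (l * snd (psi z)) = cos (l * snd (psi o)))
      by (apply Rmult_eq_reg_l with (exp (- l * fst (psi o))); [exact Ec | lra]).
    assert (Es' : sin (l * snd (psi z)) = sin (l * snd (psi o)))
      by (apply Rmult_eq_reg_l with (exp (- l * fst (psi o))); [exact Es | lra]).
    unfold Im; rewrite Rmult_minus_distr_l, cos_minus, Ec', Es'.
    pose proof (sin2_cos2 (l * snd (psi o))) as E2; unfold Rsqr in E2; lra. }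
  exists (psi o); intros z.
  assert (HIm : Im (psi z) = Im (psi o)).
  (* The scaled change of [Im psi] along the segment from 0 to [z]; it is zero at [t = 0], and
     [t = 1] gives the claim. *)
  { set (g := fun t => l * (Im (psi (t * fst z, t * snd z)) - Im (psi o))).
    assert (Hg1 : g 1 = 0).
    { apply continuous_cos_eq_1.
      - assert (Hc : continuity (fun t => l * (Im (phi (t * fst z, t * snd z)) + (- t * snd z - Im (psi o))))).
        { apply (continuity_scal (fun t => Im (phi (t * fst z, t * snd z)) + (- t * snd z - Im (psi o)))).
          apply (continuity_plus (fun t => Im (phi (t * fst z, t * snd z))) (fun t => - t * snd z - Im (psi o))).
          - now apply continuity_Im_line.
          - intros t; reg. }
        intros t; apply (continuity_pt_ext (fun t => l * (Im (phi (t * fst z, t * snd z)) + (- t * snd z - Im (psi o))))).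
        + intros s; unfold g, psi, Im; simpl; ring.
        + apply Hc.
      - unfold g; rewrite !Rmult_0_l; fold o; ring.
      - intros t; apply Hcos. }
    unfold g in Hg1.
    replace ((1 * fst z, 1 * snd z) : Cplx) with z in Hg1 by (apply Cplx_ext; simpl; ring).
    nra. }
  specialize (HRe z); unfold psi, Re, Im in *; simpl in *.
  apply Cplx_ext; simpl; lra.
Qed.

(** * Translations and their norm estimate *)

Lemma InH_norm_unique (lam beta : nat -> R) (f g : Cplx -> Cplx) (a c : nat -> Cplx) (r r' : R) :
  (forall n, a n = c n) -> InH lam beta f a r -> InH lam beta g c r' -> r = r'.
Proof.
  intros E [(s & Hs & ->) _] [(s' & Hs' & ->) _].
  f_equal; apply is_series_Reals in Hs, Hs'.
  rewrite <- (is_series_unique _ _ Hs), <- (is_series_unique _ _ Hs').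
  apply Series_ext; intros n; now rewrite E.
Qed.

Lemma InH_ext (lam beta : nat -> R) (f g : Cplx -> Cplx) (a : nat -> Cplx) (r : R) :
  (forall z, f z = g z) -> InH lam beta f a r -> InH lam beta g a r.
Proof. intros E [H1 H2]; split; [assumption|]; intros z; rewrite <- E; apply H2. Qed.

(** Translation multiplies the [n]-th coefficient by a factor of modulus [exp (- lam n * Re b)],
    which is largest at [n = 0] since [Re b >= 0]. *)
Lemma InH_translate (lam beta : nat -> R) (phi f : Cplx -> Cplx) (a : nat -> Cplx) (r : R) (b : Cplx) :
  Lambda_ok lam -> 0 <= Re b -> (forall z, phi z = Cadd z b) -> InH lam beta f a r ->
  exists r', InH lam beta (comp f phi) (fun n => Cmul (a n) (Cexp_neg (lam n) b)) r' /\
    r' <= exp (- lam 0%nat * Re b) * r.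
Proof.
  intros HL Hb Hphi [(s & Hs & ->) Hf].
  apply is_series_Reals in Hs.
  set (E := exp (- lam 0%nat * Re b)).
  assert (HE : 0 < E) by apply exp_pos.
  set (u := fun n => Cmod (Cmul (a n) (Cexp_neg (lam n) b)) ^ 2 * beta n ^ 2).
  assert (Hu : forall n, 0 <= u n <= E ^ 2 * (Cmod (a n) ^ 2 * beta n ^ 2) + 0 * (Cmod (a n) ^ 2 * beta n ^ 2)).
  { intros n; unfold u; rewrite <- !Rpow_mult_distr; split; [apply pow2_ge_0|].
    rewrite Rmult_0_l, Rplus_0_r, Cmod_mul, Cmod_Cexp_neg.
    assert (Hle : exp (- lam n * Re b) <= E).
    { apply exp_le_mono; pose proof (Lambda_ok_ge0 lam n HL); nra. }
    replace ((Cmod (a n) * exp (- lam n * Re b) * beta n) ^ 2)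
      with (exp (- lam n * Re b) ^ 2 * (Cmod (a n) * beta n) ^ 2) by ring.
    rewrite (Rpow_mult_distr E).
    apply Rmult_le_compat_r; [apply pow2_ge_0|].
    apply pow_incr; split; [left; apply exp_pos|assumption]. }
  pose proof (is_series_linear _ _ (E ^ 2) 0 _ _ Hs Hs) as HEs.
  (* The [eq_ind_r] term replaces [Rabs (u n)] by [u n], so that the upper bound in [Hu] applies. *)
  destruct (ex_series_dominated u _
    (fun n => eq_ind_r (fun y => y <= _) (proj2 (Hu n)) (Rabs_pos_eq _ (proj1 (Hu n))))
    (ex_intro _ _ HEs)) as [s' Hs'].
  exists (sqrt s'); split.
  - split; [exists s'; split; [now apply is_series_Reals|reflexivity]|].
    intros z; unfold comp; rewrite Hphi.
    generalize (Hf (Cadd z b)); apply series_C_ext; intros n.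
    rewrite Cexp_neg_add; apply Cplx_ext; simpl; ring.
  - rewrite <- (sqrt_pow2 E), <- sqrt_mult_alt by nra.
    apply sqrt_le_1_alt.
    pose proof (is_series_le _ _ _ _ (fun n => proj2 (Hu n)) Hs' HEs); lra.
Qed.

Lemma series_C_unique (u : nat -> Cplx) (s t : Cplx) : series_C u s -> series_C u t -> s = t.
Proof.
  intros [H1 H2] [H3 H4]; apply Cplx_ext; eapply uniqueness_sum; eassumption.
Qed.

(** * Necessity of the translation form and the operator norm *)

Lemma bounded_comp_translation (lam beta : nat -> R) (phi : Cplx -> Cplx) :
  Lambda_ok lam -> 0 < lam 0%nat -> CondE lam beta -> entire phi -> bounded_comp lam beta phi ->
  exists b, forall z, phi z = Cadd z b.
Proof.
  intros HL H0 HE Hphi HB.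
  destruct (Re_comp_ge lam beta phi HL H0 HE HB) as [h Hh].
  destruct HB as [M HM].
  destruct (HM _ _ _ (InH_monomial lam beta 0 (1, 0) (proj1 HE 0%nat))) as (c & r' & Hc & _).
  assert (Hcomp : forall z, comp (fun z => Cmul (1, 0) (Cexp_neg (lam 0%nat) z)) phi z
                            = Cexp_neg (lam 0%nat) (phi z))
    by (intros z; apply Cplx_ext; simpl; ring).
  apply (InH_ext _ _ _ _ _ _ Hcomp) in Hc.
  apply (translation_of_Cexp_neg (lam 0%nat) (c 0%nat)); [assumption|assumption|].
  assert (Hz : forall n, n <> 0%nat -> c n = (0, 0)).
  { intros n Hn; apply Cmod_eq_zero.
    destruct (Rle_or_lt (Cmod (c n)) 0) as [|Hpos]; [assumption|exfalso].
    assert (Hl : lam 0%nat < lam n) by (apply Lambda_ok_lt; [assumption|lia]).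
    (* A single abscissa replaces the limit at minus infinity: here [Cmod (c n) * exp (- lam n * x)]
       equals [exp 1] times the bound [exp (- lam 0 * (x - h))]. *)
    set (x := (ln (Cmod (c n)) - lam 0%nat * h - 1) / (lam n - lam 0%nat)).
    assert (Hx : (lam n - lam 0%nat) * x = ln (Cmod (c n)) - lam 0%nat * h - 1)
      by (unfold x; field; lra).
    assert (Hb : Cmod (c n) * exp (- lam n * x) <= exp (- lam 0%nat * (x - h))).
    { apply (dirichlet_coef_bound lam c (fun z => Cexp_neg (lam 0%nat) (phi z))).
      - intros k; now apply Lambda_ok_inj.
      - exact (proj2 Hc).
      - apply (ex_series_coef_exp lam beta); try assumption; now apply InH_ex_series in Hc.
      - intros y; rewrite Cmod_Cexp_neg; apply exp_le_mono.
        specialize (Hh (x, y)); simpl in Hh; nra. }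
    rewrite <- (exp_ln (Cmod (c n))), <- exp_plus in Hb by assumption.
    apply Rle_not_lt in Hb; apply Hb, exp_increasing; lra. }
  (* Only the term of index 0 survives, so [exp (- lam 0 * phi)] is [c 0] times the first
     exponential. *)
  intros z; apply (series_C_unique _ _ _ (proj2 Hc z)).
  apply (series_C_single (fun n => Cmul (c n) (Cexp_neg (lam n) z))).
  intros n Hn; rewrite Hz by assumption; apply Cplx_ext; simpl; ring.
Qed.

(** Each monomial is an eigenvector with eigenvalue of modulus [exp (- lam n * Re b)]; these are
    bounded by [M] although [lam n] is unbounded. *)
Lemma bounded_translation_Re_ge0 (lam beta : nat -> R) (phi : Cplx -> Cplx) (b : Cplx) :
  Lambda_ok lam -> 0 < lam 0%nat -> CondE lam beta -> (forall z, phi z = Cadd z b) ->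
  bounded_comp lam beta phi -> 0 <= Re b.
Proof.
  intros HL H0 HE Hphi [M HM].
  assert (Hexp : forall n, exp (- lam n * Re b) <= M).
  { intros n; pose proof (proj1 HE n) as Hb.
    destruct (HM _ _ _ (InH_monomial lam beta n (1, 0) Hb)) as (c & r' & Hc & Hle).
    pose proof (InH_monomial lam beta n (Cexp_neg (lam n) b) Hb) as Hk.
    assert (E : forall z, comp (fun z => Cmul (1, 0) (Cexp_neg (lam n) z)) phi z =
                          Cmul (Cexp_neg (lam n) b) (Cexp_neg (lam n) z)).
    { intros z; unfold comp; rewrite Hphi, Cexp_neg_add; apply Cplx_ext; simpl; ring. }
    apply (InH_ext _ _ _ _ _ _ E) in Hc.
    rewrite (InH_norm_unique _ _ _ _ _ _ _ _ (InH_unique _ _ _ _ _ _ _ HL H0 HE Hc Hk) Hc Hk) in Hle.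
    rewrite Cmod_Cexp_neg, Cmod_real in Hle by lra.
    apply Rmult_le_reg_r with (beta n); lra. }
  destruct (Rle_or_lt 0 (Re b)) as [|Hneg]; [assumption|exfalso].
  destruct HL as (_ & _ & Hinf & _).
  (* If [Re b < 0], this threshold gives [- lam N * Re b > M], and [exp t >= 1 + t] contradicts the
     bound [M]. *)
  destruct (Hinf (M / - Re b)) as [N HN]; specialize (HN N (le_n N)); specialize (Hexp N).
  apply Rlt_div_l in HN; [|lra].
  pose proof (exp_ineq1_le (- lam N * Re b)); lra.
Qed.

Theorem theorem4p5 (lam beta : nat -> R) (phi : Cplx -> Cplx) :
  Lambda_ok lam -> 0 < lam 0%nat -> CondE lam beta -> entire phi ->
  (bounded_comp lam beta phi <->
     exists b : Cplx, 0 <= Re b /\ forall z : Cplx, phi z = Cadd z b) /\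
  (forall b : Cplx, 0 <= Re b -> (forall z : Cplx, phi z = Cadd z b) ->
     is_lub (opnorm_set lam beta phi) (exp (- lam 0%nat * Re b))).
Proof.
  intros HL H0 HE Hphi; split; [split|].
  - intros HB.
    destruct (bounded_comp_translation lam beta phi HL H0 HE Hphi HB) as [b Hb].
    exists b; split; [now apply (bounded_translation_Re_ge0 lam beta phi) | assumption].
  - intros (b & Hb & Htr); exists (exp (- lam 0%nat * Re b)); intros f a r Hf.
    destruct (InH_translate lam beta phi f a r b HL Hb Htr Hf) as (r' & Hr' & Hle).
    eexists; exists r'; split; eassumption.
  - intros b Hb Htr; pose proof (exp_pos (- lam 0%nat * Re b)) as Hpos; split.
    + intros t (f & a & r & c & Hf & Hr & Hc).
      destruct (InH_translate lam beta phi f a r b HL Hb Htr Hf) as (r' & Hr' & Hle).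
      (* By uniqueness the coefficients [c] are those of the translate, so [t] is the norm already
         estimated. *)
      rewrite (InH_norm_unique _ _ _ _ _ _ _ _ (InH_unique _ _ _ _ _ _ _ HL H0 HE Hc Hr') Hc Hr').
      nra.
    + intros B HB; apply HB.
      pose proof (proj1 HE 0%nat) as Hb0.
      assert (Hinv : 0 < / beta 0%nat) by now apply Rinv_0_lt_compat.
      (* The supremum is attained at the first monomial, normalised by [/ beta 0]. *)
      pose proof (InH_monomial lam beta 0 (/ beta 0%nat, 0) Hb0) as Hf.
      pose proof (InH_monomial lam beta 0 (Cmul (/ beta 0%nat, 0) (Cexp_neg (lam 0%nat) b)) Hb0) as Hg.
      rewrite Cmod_mul, Cmod_Cexp_neg, Cmod_real in Hg by lra.
      rewrite Cmod_real in Hf by lra.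
      replace (/ beta 0%nat * exp (- lam 0%nat * Re b) * beta 0%nat)
        with (exp (- lam 0%nat * Re b)) in Hg by (field; lra).
      rewrite Rinv_l in Hf by lra.
      eexists; eexists; exists 1; eexists; split; [exact Hf|split; [lra|]].
      eapply InH_ext; [|exact Hg].
      intros z; unfold comp; rewrite Htr, Cexp_neg_add; apply Cplx_ext; simpl; ring.
Qed.
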